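(* Let $\mathcal M$ be a sweep oriented matroid on $\binom{[n]}{2}$ of rank $r$. Then its number of sweep permutations (equivalently, of topes) satisfies \[|\Pi(\mathcal M)|\le\sum_{i=0}^{\lfloor\frac{r-1}{2}\rfloor}2\,c(n,n-r+1+2i),\] where $c(n,k)$ are the unsigned Stirling numbers of the first kind. Equality holds, for example, for the sweep oriented matroids of generic configurations of $n$ points in $\mathbb R^{r-1}$.
   Context: Oriented matroids are given by covectors (standard covector axioms), ordered componentwise by $0\prec\pm$; topes are maximal covectors and the rank is the length of maximal chains. $\binom{[n]}{2}$ is the set of pairs $(i,j)$, $i<j$; for an ordered partition $I$ of $[n]$ with block-index map $p_I$, $X^I_{(i,j)}=+,-,0$ according as $p_I(i)<,>,=p_I(j)$; a sweep oriented matroid is an oriented matroid on $\binom{[n]}{2}$ all of whose covectors are of the form $X^I$. Its sweep permutations $\Pi(\mathcal M)$ are the permutations (ordered partitions into singletons) corresponding to its topes. For a point configuration $(a_1,\dots,a_n)$ in $\mathbb R^{r-1}$, its sweep oriented matroid is the oriented matroid on $\binom{[n]}{2}$ with covectors $(\mathrm{sign}\langle u,a_j-a_i\rangle)_{(i,j)}$ for $u\in\mathbb R^{r-1}$.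
   Formalization: Equality is stated for n ≥ 2 generic points in R^d, d ≥ 1, at their actual rank min(d,n-1), since points in R^{r-1} never have rank r; sweep permutations and topes are equinumerous only for loopless matroids (the bound holds for both); r > 0 is assumed. *)

(* Defs.v *)
From HB Require Import structures.
From mathcomp Require Import all_boot all_fingroup all_algebra.
From mathcomp Require Import boolp reals.
From mathcomp Require Import mpoly.

Set Implicit Arguments.
Unset Strict Implicit.
Unset Printing Implicit Defensive.

Import GRing.Theory Num.Theory.

Inductive sign := Zero | Plus | Minus.

Definition bool_of_sign (s : sign) : option bool :=
  match s with Zero => None | Plus => Some true | Minus => Some false end.
Definition sign_of_bool (b : option bool) : sign :=
  match b with None => Zero | Some true => Plus | Some false => Minus end.
Lemma bool_of_signK : cancel bool_of_sign sign_of_bool.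
Proof. by case. Qed.
HB.instance Definition _ := Finite.copy sign (can_type bool_of_signK).

Definition opp_sign (s : sign) : sign :=
  match s with Zero => Zero | Plus => Minus | Minus => Plus end.

Section OrientedMatroids.
Variable E : finType.

Definition signvec := {ffun E -> sign}.
Implicit Types (X Y Z : signvec) (L C : {set signvec}).

Definition sv0 : signvec := [ffun=> Zero].
Definition sv_opp X : signvec := [ffun e => opp_sign (X e)].
Definition sv_comp X Y : signvec :=
  [ffun e => if X e == Zero then Y e else X e].
Definition separates X Y (e : E) : bool :=
  (X e != Zero) && (Y e == opp_sign (X e)).

(* Covector axioms. *)
Definition oriented_matroid L : Prop :=
  [/\ sv0 \in L,
      forall X, X \in L -> sv_opp X \in L,
      forall X Y, X \in L -> Y \in L -> sv_comp X Y \in L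
    & forall X Y e, X \in L -> Y \in L -> separates X Y e ->
        exists Z, [/\ Z \in L, Z e = Zero &
          forall f, ~~ separates X Y f -> Z f = sv_comp X Y f]].

Definition sv_le X Y : bool := [forall e, (X e == Zero) || (X e == Y e)].

Definition topes L : {set signvec} :=
  [set X in L | [forall Y in L, sv_le X Y ==> (Y == X)]].

Definition chain L C : bool :=
  (C \subset L) && [forall X in C, forall Y in C, sv_le X Y || sv_le Y X].
Definition maximal_chain L C : bool := maxset (chain L) C.

(* All maximal chains of covectors of an oriented matroid have the same
   length; a chain with k elements has length k - 1. *)
Definition rank L : nat := \max_(C | maximal_chain L C) #|C|.-1.

Definition loopless L : Prop := forall e, exists2 X, X \in L & X e != Zero.

End OrientedMatroids.

Section Sweeps.
Variable n : nat.

Definition pairs := {ij : 'I_n * 'I_n | ij.1 < ij.2}.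
Implicit Types (I : seq {set 'I_n}) (L : {set signvec pairs}).

Definition ordered_partition I : bool :=
  uniq I && partition [set B in I] [set: 'I_n].

Definition block_index I (i : 'I_n) : nat := find (fun B : {set 'I_n} => i \in B) I.

Definition partition_signvec I : signvec pairs :=
  [ffun e => let p := block_index I in
     if p (val e).1 < p (val e).2 then Plus
     else if p (val e).2 < p (val e).1 then Minus else Zero].

Definition sweep_oriented_matroid L : Prop :=
  oriented_matroid L /\
  forall X, X \in L -> exists2 I, ordered_partition I & X = partition_signvec I.

(* A permutation s is the ordered partition ({s 0}, ..., {s (n-1)}). *)
Definition perm_partition (s : 'S_n) : seq {set 'I_n} :=
  [seq [set s i] | i <- enum 'I_n].

Definition sweep_permutations L : {set 'S_n} :=
  [set s | partition_signvec (perm_partition s) \in topes L].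

End Sweeps.

Section Configurations.
Variables (R : realType) (n d : nat).
Local Open Scope ring_scope.

Definition sign_of (x : R) : sign :=
  if 0 < x then Plus else if x < 0 then Minus else Zero.

(* The rows of a are the points of the configuration. *)
Definition sweep_signvec (a : 'M[R]_(n, d)) (u : 'rV[R]_d) : signvec (pairs n) :=
  [ffun e => sign_of (\sum_k u 0 k * (a (val e).2 k - a (val e).1 k))].

Definition sweep_om (a : 'M[R]_(n, d)) : {set signvec (pairs n)} :=
  [set X | `[< exists u, X = sweep_signvec a u >]].

(* Q holds for generic configurations of n points: it holds for all those
   outside some proper algebraic subset of (R^d)^n. *)
Definition generically (Q : 'M[R]_(n, d) -> Prop) : Prop :=
  exists P : {mpoly R[n * d]}, P != 0 /\
    forall a : 'M[R]_(n, d), P.@[fun k => mxvec a 0 k] != 0 -> Q a.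

End Configurations.

(* Unsigned Stirling numbers of the first kind: permutations of [n] with
   exactly k cycles, fixed points included. *)
Definition stirling1 (n k : nat) : nat := #|[set s : 'S_n | #|porbits s| == k]|.

(* For r > 0 the range is 0 <= i <= floor((r - 1) / 2). *)
Definition sweep_bound (n r : nat) : nat :=
  \sum_(0 <= i < ((r - 1) %/ 2).+1) 2 * stirling1 n (n - r + 1 + 2 * i).

(* Main.v *)
Require Import Defs.
From mathcomp Require Import all_boot all_fingroup all_algebra.
From mathcomp Require Import boolp reals.
From mathcomp Require Import order mpoly zify.

(* Let N(L, A) be the number of restrictions to A of covectors of L that vanish
   nowhere on A. For a nonloop e outside A, N(L, A + e) = N(L, A) + N(L/e, A).
   Adding the pairs (k, m), k < m, one at a time to the pairs inside [m], and
   noting that after contracting (k, m) the pairs (i, m) and (i, k) become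
   parallel, one gets N(L, m + 1) = N(L, m) + sum_k N(L/(k, m), m). Contraction
   of a nonloop lowers the rank, so N(L, n) is at most the solution f(n, r) of
   f(m + 1, r) = f(m, r) + m f(m, r - 1); by the recursion of the Stirling
   numbers, f(n, r) is the bound when 0 < r < n.

   The edges (k, m) contracted along the recursion form a forest, and equality
   holds if no loop arises, which for a point configuration means that the edge
   vectors of every such forest with at most d edges are linearly independent.
   The rank of a generic configuration is then found by counting: f(n, d) <=
   N <= f(n, rank), while f(n, .) increases strictly up to n - 1. *)

Set Implicit Arguments.
Unset Strict Implicit.
Unset Printing Implicit Defensive.

Import Order.TTheory GRing.Theory Num.Theory.

(** * Covectors vanishing nowhere on a set *)

Section RestrictedTopes.
Variable E : finType.
Implicit Types (X Y Z W : signvec E) (L C : {set signvec E}) (A B K : {set E}).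

Definition full A X : bool := [forall e in A, X e != Zero].

(** Padding with [Zero] keeps the restrictions to different sets in one type. *)
Definition restr A X : signvec E := [ffun e => if e \in A then X e else Zero].

(** The ground set stays [E]; the contracted elements become loops. *)
Definition contract L A : {set signvec E} := [set X in L | [forall e in A, X e == Zero]].

Definition num_full L A : nat := #|[set restr A X | X in L & full A X]|.

Lemma restrP A X Y : restr A X = restr A Y <-> {in A, X =1 Y}.
Proof.
split=> [/ffunP eqXY e eA | eqXY].
  by move: (eqXY e); rewrite !ffunE eA.
by apply/ffunP=> e; rewrite !ffunE; case: ifP => // /eqXY.
Qed.

Lemma fullP A X : reflect {in A, forall e, X e != Zero} (full A X).
Proof. exact: forall_inP. Qed.

Lemma contractP L A X :
  reflect (X \in L /\ {in A, forall e, X e = Zero}) (X \in contract L A).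
Proof.
rewrite inE; apply: (iffP andP) => -[XL h]; split=> //.
  by move=> e eA; apply/eqP/(forall_inP h).
by apply/forall_inP=> e /h ->.
Qed.

Lemma contract_sub L A : contract L A \subset L.
Proof. by apply/subsetP=> X /contractP[]. Qed.

Lemma contract1P L e X : reflect (X \in L /\ X e = Zero) (X \in contract L [set e]).
Proof.
apply: (iffP (contractP _ _ _)) => -[XL h]; split=> //; first by apply: h; rewrite inE.
by move=> f /set1P ->.
Qed.

Lemma contractU1 L A e : contract (contract L A) [set e] = contract L (e |: A).
Proof.
apply/setP=> X; apply/contract1P/contractP => [[/contractP[XL h] Xe]|[XL h]].
  by split=> // f /setU1P[->|/h].
split; last by apply: h; rewrite setU11.
by apply/contractP; split=> // f fA; apply: h; rewrite setU1r.
Qed.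

Lemma oriented_matroid_contract L A :
  oriented_matroid L -> oriented_matroid (contract L A).
Proof.
case=> L0 Lopp Lcomp Lelim; split.
- by apply/contractP; split=> // e _; rewrite ffunE.
- move=> X /contractP[XL XA]; apply/contractP; split; first exact: Lopp.
  by move=> e eA; rewrite ffunE XA.
- move=> X Y /contractP[XL XA] /contractP[YL YA].
  by apply/contractP; split; [exact: Lcomp | move=> e eA; rewrite ffunE XA ?YA].
- move=> X Y e /contractP[XL XA] /contractP[YL YA] sep.
  have [Z [ZL Ze Zf]] := Lelim _ _ _ XL YL sep.
  exists Z; split=> //; apply/contractP; split=> // f fA.
  by rewrite Zf ?ffunE /separates XA ?YA.
Qed.

Lemma opp_sign_eq0 s : (opp_sign s == Zero) = (s == Zero).
Proof. by case: s. Qed.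

Lemma nonloop_sign L e s : oriented_matroid L -> s != Zero ->
  (exists2 X, X \in L & X e != Zero) -> exists2 X, X \in L & X e = s.
Proof.
case=> _ Lopp _ _ s0 [X XL Xe].
have [eqs|neqs] := eqVneq (X e) s; first by exists X.
exists (sv_opp X); first exact: Lopp.
by rewrite ffunE; case: (X e) s Xe s0 neqs => -[].
Qed.

(** Restricting further from [B] to [A] is then a bijection. This serves when the elements of [B]
    are parallel to elements of [A]. *)
Lemma num_full_eq L A B : A \subset B ->
  {in L, forall X, full A X -> full B X} ->
  {in L &, forall X Y, {in A, X =1 Y} -> {in B, X =1 Y}} ->
  num_full L B = num_full L A.
Proof.
move=> sAB hfull heq; rewrite /num_full.
have -> : [set restr A X | X in L & full A X] =
          restr A @: [set restr B X | X in L & full B X].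
  apply/setP=> Y; apply/imsetP/imsetP => [[X]|[_ /imsetP[X + ->]]].
    rewrite inE => /andP[XL fX] ->; exists (restr B X).
      by rewrite imset_f // inE XL hfull.
    by apply/restrP=> e eA; rewrite ffunE (subsetP sAB).
  rewrite inE => /andP[XL /fullP fX] ->; exists X.
    by rewrite inE XL; apply/fullP=> e /(subsetP sAB)/fX.
  by apply/restrP=> e eA; rewrite ffunE (subsetP sAB).
rewrite card_in_imset // => _ _ /imsetP[X + ->] /imsetP[Y + ->].
rewrite !inE => /andP[XL _] /andP[YL _] /restrP h.
apply/restrP/heq => // e eA; move: (h e eA).
by rewrite !ffunE (subsetP sAB).
Qed.

(* Deletion-contraction: the restrictions extending to [e] with sign [+] and
   those extending with sign [-] together cover all of them, and by covector
   elimination they have in common exactly those extending by [0]. *)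
Lemma num_full_setU1 L A e : oriented_matroid L -> e \notin A ->
  (exists2 X, X \in L & X e != Zero) ->
  num_full L (e |: A) = num_full L A + num_full (contract L [set e]) A.
Proof.
move=> omL eA nle; have [L0 Lopp Lcomp Lelim] := omL.
pose D s := [set restr A X | X in L & full A X && (X e == s)].
have DP s Y : reflect (exists2 X, [/\ X \in L, full A X & X e = s] & Y = restr A X)
                      (Y \in D s).
  apply: (iffP imsetP) => -[X].
    by rewrite inE => /and3P[XL fX /eqP Xe] ->; exists X.
  by case=> XL fX Xe ->; exists X => //; rewrite inE XL fX Xe /=.
(* Composing with a covector [W] nonzero at [e] gives a zero at [e] either sign; the entries on [A]
   are nonzero and do not change. *)
have shift s X : s != Zero -> X \in L -> full A X -> X e = Zero ->
    restr A X \in D s.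
  move=> s0 XL /fullP fX Xe; have [W WL We] := nonloop_sign omL s0 nle.
  have eqXW : {in A, X =1 sv_comp X W}.
    by move=> f fA; rewrite ffunE (negbTE (fX f fA)).
  apply/DP; exists (sv_comp X W); last exact/restrP.
  split; [exact: Lcomp | | by rewrite ffunE Xe].
  by apply/fullP=> f fA; rewrite -eqXW ?fX.
have DU : D Plus :|: D Minus = [set restr A X | X in L & full A X].
  apply/setP=> Y; rewrite in_setU; apply/idP/imsetP.
    by case/orP=> /DP[X [XL fX _] ->]; exists X; rewrite // inE XL.
  case=> X; rewrite inE => /andP[XL fX] ->.
  case Xe: (X e); first by rewrite shift.
    by apply/orP; left; apply/DP; exists X.
  by apply/orP; right; apply/DP; exists X.
have DI : D Plus :&: D Minus =
          [set restr A X | X in contract L [set e] & full A X].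
  apply/setP=> Y; rewrite in_setI; apply/andP/imsetP.
    case=> /DP[X1 [X1L fX1 X1e] ->] /DP[X2 [X2L fX2 X2e] /restrP eqX].
    have sep : separates X1 X2 e by rewrite /separates X1e X2e.
    have [Z [ZL Ze Zf]] := Lelim _ _ _ X1L X2L sep.
    have eqZ : {in A, X1 =1 Z}.
      move=> f fA; have X1f := fullP _ _ fX1 f fA.
      rewrite Zf ?ffunE ?(negbTE X1f) //.
      by rewrite /separates -eqX //; case: (X1 f) X1f.
    exists Z; last exact/restrP.
    rewrite inE; apply/andP; split; first exact/contract1P.
    by apply/fullP=> f fA; rewrite -eqZ ?(fullP _ _ fX1).
  case=> X; rewrite inE => /andP[/contract1P[XL Xe] fX] ->.
  by rewrite !shift.
rewrite /num_full -DU -DI cardsUI.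
(* [T s] lives on [e |: A], [D s] on [A]; forgetting [e], where the sign is fixed, is injective on
   [T s]. *)
pose T s := [set X in [set restr (e |: A) X | X in L & full (e |: A) X] | X e == s].
have TD s : s != Zero -> #|T s| = #|D s|.
  move=> s0; have -> : D s = restr A @: T s.
    apply/setP=> Y; apply/DP/imsetP.
      case=> X [XL fX Xe] ->; exists (restr (e |: A) X).
        rewrite inE ffunE setU11 Xe eqxx andbT imset_f // inE XL.
        by apply/fullP=> f /setU1P[->|/(fullP _ _ fX)//]; rewrite Xe.
      by apply/restrP=> f fA; rewrite ffunE setU1r.
    case=> _ /setIdP[/imsetP[X + ->]].
    rewrite inE ffunE setU11 => /andP[XL /fullP fX] /eqP Xe ->.
    exists X; last by apply/restrP=> f fA; rewrite ffunE setU1r.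
    by split=> //; apply/fullP=> f fA; rewrite fX ?setU1r.
  rewrite card_in_imset // => X Y /setIdP[/imsetP[X' _ ->] /eqP Xe]
    /setIdP[/imsetP[Y' _ ->] /eqP Ye] /restrP h.
  apply/ffunP=> f; have [->|fe] := eqVneq f e; first by rewrite Xe Ye.
  have [fA|fA] := boolP (f \in A); first exact: h.
  by rewrite !ffunE !inE (negbTE fe) (negbTE fA).
rewrite -(TD Plus) // -(TD Minus) // -[RHS]cardsUI.
have -> : T Plus :&: T Minus = set0.
  by apply/setP=> X; rewrite !inE; case: (X e); rewrite ?andbF.
rewrite cards0 addn0; apply: eq_card => X; rewrite in_setU !inE -andb_orr.
case: imsetP => //= -[{}X + ->]; rewrite inE ffunE setU11 => /andP[_ /fullP fX].
by move: (fX e (setU11 _ _)); case: (X e).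
Qed.

Definition parallel_in L (e f : E) : Prop :=
  (forall X, X \in L -> X e = X f) \/ (forall X, X \in L -> X e = opp_sign (X f)).

(** Let [e] be the last element of [K] to be added. After contracting [e], the others are parallel
    to elements of [A], so the contraction term involves [A] alone. *)
Lemma num_full_setU L A K : oriented_matroid L ->
  {in K, forall e, e \notin A /\ exists2 X, X \in L & X e != Zero} ->
  {in K &, forall e f, e != f ->
     exists2 g, g \in A & parallel_in (contract L [set e]) f g} ->
  num_full L (A :|: K) = num_full L A + \sum_(e in K) num_full (contract L [set e]) A.
Proof.
move=> omL; elim: {K}_.+1 {-2}K (ltnSn #|K|) => // c IHc K.
have [->|[e eK]] := set_0Vmem K; first by rewrite setU0 big_set0 addn0.
rewrite ltnS (cardsD1 e) eK add1n => ltc hK hpar.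
have sK : K :\ e \subset K by rewrite subsetDl.
have [eA nle] := hK _ eK.
rewrite (big_setD1 e) //= addnCA -IHc //; first last.
- by move=> f g /(subsetP sK) fK /(subsetP sK); apply: hpar.
- by move=> f /(subsetP sK); apply: hK.
rewrite -{1}(setD1K eK) setUCA num_full_setU1 //; last by rewrite !inE eqxx /= orbF.
rewrite addnC; congr (_ + _).
have hp f : f \in A :|: K :\ e ->
    exists2 g, g \in A & parallel_in (contract L [set e]) f g.
  case/setUP=> [fA|/setD1P[fe fK]]; first by exists f => //; left.
  by apply: hpar => //; rewrite eq_sym.
apply: num_full_eq; first exact: subsetUl.
  move=> X XL /fullP fX; apply/fullP=> f /hp[g gA [] -> //]; first exact: fX.
  by rewrite opp_sign_eq0 fX.
move=> X Y XL YL eqXY f /hp[g gA [] h]; rewrite !h //; first exact: eqXY.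
by rewrite eqXY.
Qed.

(** * Chains, rank and topes *)

Lemma sv_leP X Y : reflect (forall e, X e != Zero -> Y e = X e) (sv_le X Y).
Proof.
apply: (iffP forallP) => h e; have := h e.
  by case/orP=> [->|/eqP ->].
by case: eqP => //= _ /(_ isT) ->.
Qed.

Lemma sv_le_trans Y X Z : sv_le X Y -> sv_le Y Z -> sv_le X Z.
Proof.
move=> /sv_leP XY /sv_leP YZ; apply/sv_leP=> e Xe.
by rewrite YZ XY // XY.
Qed.

Lemma sv_le_comp X Y : sv_le X (sv_comp X Y).
Proof. by apply/sv_leP=> e Xe; rewrite ffunE (negbTE Xe). Qed.

Lemma chainP L C : reflect (C \subset L /\ {in C &, forall X Y, sv_le X Y || sv_le Y X})
                           (chain L C).
Proof.
apply: (iffP andP) => -[sCL h]; split=> //.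
  by move=> X Y XC YC; apply: (forall_inP (forall_inP h X XC)).
by apply/forall_inP=> X XC; apply/forall_inP=> Y; apply: h.
Qed.

Lemma chain_leq_rank L C : chain L C -> #|C| <= (rank L).+1.
Proof.
move=> chC; have [C' maxC' sCC'] := maxset_exists chC.
apply: leq_trans (subset_leq_card sCC') _.
suff : #|C'|.-1 <= rank L by case: #|C'|.
by rewrite /rank (bigD1 C') ?leq_maxl.
Qed.

Lemma rank_leq L m : (forall C, chain L C -> #|C| <= m.+1) -> rank L <= m.
Proof.
move=> h; apply/bigmax_leqP=> C /maxsetp /h.
by case: #|C|.
Qed.

(* A strictly monotone function is injective on chains. *)
Lemma rank_leq_height L m (g : signvec E -> nat) :
  {in L &, forall X Y, sv_le X Y -> X != Y -> g X < g Y} ->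
  {in L, forall X, g X <= m} -> rank L <= m.
Proof.
move=> mono bnd; apply: rank_leq => C /chainP[/subsetP sCL tot].
rewrite -[m.+1]card_ord -(card_in_imset (f := fun X => inord (g X) : 'I_m.+1)).
  exact: max_card.
move=> X Y XC YC /(congr1 (@nat_of_ord _)).
rewrite inordK ?ltnS ?bnd ?sCL // inordK ?ltnS ?bnd ?sCL // => eqg.
apply/eqP; apply: contraT => neq; case/orP: (tot _ _ XC YC) => le.
  by have := mono _ _ (sCL _ XC) (sCL _ YC) le neq; rewrite eqg ltnn.
rewrite eq_sym in neq.
by have := mono _ _ (sCL _ YC) (sCL _ XC) le neq; rewrite eqg ltnn.
Qed.

(** This is how contracting a nonloop lowers the rank: the top [T] of the chain, composed with a
    covector [W] nonzero at [e], lies above the whole chain and outside the contraction. *)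
Lemma chain_contract L C e : oriented_matroid L ->
  (exists2 X, X \in L & X e != Zero) -> chain (contract L [set e]) C ->
  exists2 C', chain L C' & #|C'| = #|C|.+1.
Proof.
move=> [L0 _ Lcomp _] [W WL We] /chainP[/subsetP sC tot].
have [C0|[X0 X0C]] := set_0Vmem C.
  exists [set sv0 E]; last by rewrite cards1 C0 cards0.
  apply/chainP; split; first by rewrite sub1set.
  by move=> X Y /set1P -> /set1P ->; rewrite orbb; apply/sv_leP=> f; rewrite ffunE.
(* In a chain, the covector with the largest support is the top. *)
case: (@arg_maxnP _ X0 (mem C) (fun X => #|[set f | X f != Zero]|)) => //= T TC maxT.
have leT X : X \in C -> sv_le X T.
  move=> XC; case/orP: (tot _ _ XC TC) => // leTX.
  apply/sv_leP=> f Xf; apply/esym/(sv_leP _ _ leTX).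
  have : [set f | T f != Zero] \subset [set f | X f != Zero].
    by apply/subsetP=> h; rewrite !inE => Th; rewrite (sv_leP _ _ leTX).
  move/subset_leqif_card/geq_leqif; rewrite maxT // => /esym/subsetP/(_ f).
  by rewrite !inE; apply.
have /contract1P[TL Te] := sC _ TC.
exists (sv_comp T W |: C).
  apply/chainP; split.
    by apply/subsetP=> X /setU1P[->|/sC/contract1P[]//]; apply: Lcomp.
  have leTW X : X \in C -> sv_le X (sv_comp T W).
    by move/leT => le; apply: sv_le_trans le (sv_le_comp _ _).
  move=> X Y /setU1P[->|XC] /setU1P[->|YC].
  - by rewrite orbb; apply/sv_leP.
  - by rewrite leTW ?orbT.
  - by rewrite leTW.
  - exact: tot.
rewrite cardsU1; case: (boolP (_ \in C)) => // /sC/contract1P[_].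
by rewrite ffunE Te /= => We0; rewrite We0 in We.
Qed.

(** A tope equals its composition with any covector, since the composition lies above it. *)
Lemma topes_full L X : oriented_matroid L -> X \in topes L ->
  forall e, (exists2 Y, Y \in L & Y e != Zero) -> X e != Zero.
Proof.
move=> [_ _ Lcomp _]; rewrite inE => /andP[XL /forall_inP maxX] e [Y YL Ye].
have := maxX _ (Lcomp _ _ XL YL); rewrite sv_le_comp /= => /eqP/ffunP/(_ e).
by rewrite ffunE; case: eqP => // -> Ye0; rewrite Ye0 in Ye.
Qed.

Lemma full_topes L X : X \in L -> full setT X -> X \in topes L.
Proof.
move=> XL /fullP fX; rewrite inE XL; apply/forall_inP=> Y YL; apply/implyP.
by move=> /sv_leP le; apply/eqP/ffunP=> e; rewrite le ?fX.
Qed.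

End RestrictedTopes.

(** * Stirling numbers *)

(** [ord_max] is a cycle of its own; the other cycles are the images of those of [s]. *)
Lemma card_porbits_lift n (s : 'S_n) :
  #|porbits (lift_perm ord_max ord_max s)| = #|porbits s|.+1.
Proof.
set m : 'I_n.+1 := ord_max; set t := lift_perm _ _ s.
have tl i x : (t ^+ i)%g (lift m x) = lift m ((s ^+ i)%g x).
  elim: i => [|i IHi]; first by rewrite !expg0 !perm1.
  by rewrite !expgSr !permM IHi lift_perm_lift.
have tm i : (t ^+ i)%g m = m.
  elim: i => [|i IHi]; first by rewrite expg0 perm1.
  by rewrite expgSr permM IHi lift_perm_id.
have pl x : porbit t (lift m x) = lift m @: porbit s x.
  apply/setP=> y; apply/porbitP/imsetP => [[i ->]|[_ /porbitP[i ->] ->]].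
    by exists ((s ^+ i)%g x); rewrite ?tl // mem_porbit.
  by exists i; rewrite tl.
have pm : porbit t m = [set m].
  apply/setP=> y; rewrite inE; apply/porbitP/eqP => [[i ->]|->]; first exact: tm.
  by exists 0; rewrite expg0 perm1.
have -> : porbits t = [set m] |: [set lift m @: (A : {set 'I_n}) | A in porbits s].
  apply/setP=> A; apply/imsetP/setU1P => [[x _ ->]|[->|]]; last 2 first.
  - by exists m.
  - by case/imsetP=> _ /imsetP[x _ ->] ->; exists (lift m x).
  have [y ->|->] := unliftP m x; last by left.
  by right; rewrite pl imset_f // imset_f.
rewrite cardsU1 card_imset; last exact/imset_inj/lift_inj.
case: imsetP => // -[_ /imsetP[x _ ->] /setP/(_ m)].
rewrite inE eqxx => /esym/imsetP[y _ /eqP].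
by rewrite (negbTE (neq_lift _ _)).
Qed.

(* Every permutation of [n+1] is uniquely [tperm m k * t] with [m] the last
   point and [t] fixing [m]; left multiplication by [tperm m k] inserts [m] in
   the cycle of [k]. *)
Lemma stirling1_rec n k :
  stirling1 n.+1 k.+1 = n * stirling1 n k.+1 + stirling1 n k.
Proof.
set m : 'I_n.+1 := ord_max.
pose F (ks : 'I_n.+1 * 'S_n) : 'S_n.+1 := (tperm m ks.1 * lift_perm m m ks.2)%g.
have Fm c s : (F (c, s))^-1%g m = c.
  by rewrite /F invMg permM lift_permV lift_perm_id tpermV tpermL.
have F_inj : injective F.
  move=> [c s] [c' s'] eqF; have eqc : c = c' by rewrite -(Fm c s) eqF Fm.
  move: eqF; rewrite /F eqc /= => /mulgI eqs; congr (_, _).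
  apply/permP=> x; apply: (@lift_inj _ m).
  by rewrite -!(lift_perm_lift m m) eqs.
have orbF c s : #|porbits (F (c, s))| = (c == m) + #|porbits s|.
  have [->|neq] := eqVneq c m.
    by rewrite /F /= tperm1 mul1g card_porbits_lift.
  (* The transposition merges the fixed point [m] with the cycle of [c], which undoes the extra
     cycle of the lift. *)
  have := porbits_mul_tperm (lift_perm m m s) m c; rewrite /= card_porbits_lift.
  rewrite /F /= (eq_sym m) neq add0n.
  suff -> : m \notin porbit (lift_perm m m s) c.
    by rewrite /= addn1 addn2 => -[].
  rewrite porbit_sym; apply: contra neq => /porbitP[i ->].
  elim: i => [|i]; first by rewrite expg0 perm1.
  by rewrite expgSr permM => /eqP ->; rewrite lift_perm_id.
have -> : stirling1 n.+1 k.+1 =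
    \sum_(c : 'I_n.+1) #|[set s : 'S_n | (c == m) + #|porbits s| == k.+1]|.
  rewrite /stirling1 -sum1_card.
  rewrite (reindex F) /=; last first.
    apply: onW_bij; apply: inj_card_bij F_inj _.
    by rewrite card_prod card_ord !card_Sn factS.
  rewrite (eq_bigl (fun cs => (cs.1 == m) + #|porbits cs.2| == k.+1)); last first.
    by case=> c s; rewrite inE orbF.
  rewrite -(pair_big_dep xpredT (fun c s => (c == m) + #|porbits s| == k.+1) (fun _ _ => 1)) /=.
  by apply: eq_bigr => c _; rewrite -sum1_card; apply: eq_bigl => s; rewrite inE.
rewrite big_ord_recr /= eqxx /= addnC addnC; congr (_ + _).
have <- : \sum_(i < n) stirling1 n k.+1 = n * stirling1 n k.+1 by rewrite sum_nat_const card_ord.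
apply: eq_bigr => i _; suff -> : (widen_ord (leqnSn n) i == m) = false by [].
by apply/negbTE; rewrite -val_eqE /= neq_ltn ltn_ord.
Qed.

Lemma stirling1_gt n k : n < k -> stirling1 n k = 0.
Proof.
move=> ltnk; apply/eqP; rewrite cards_eq0; apply/eqP/setP=> s; rewrite !inE.
apply/negbTE; rewrite neq_ltn (leq_ltn_trans _ ltnk) //.
by apply: leq_trans (leq_imset_card _ _) _; rewrite card_ord.
Qed.

Lemma stirling1_0 n : stirling1 n.+1 0 = 0.
Proof.
apply/eqP; rewrite cards_eq0; apply/eqP/setP=> s; rewrite !inE cards_eq0.
by apply/negbTE/set0Pn; exists (porbit s ord0); rewrite imset_f.
Qed.

Lemma stirling1_diag n : stirling1 n n = 1.
Proof.
elim: n => [|n IHn]; last by rewrite stirling1_rec IHn stirling1_gt ?muln0.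
rewrite /stirling1; apply/eqP/cards1P; exists 1%g; apply/setP=> s; rewrite !inE.
have -> : s = 1%g by apply/permP=> -[].
rewrite eqxx cards_eq0; apply/eqP/setP=> A; rewrite inE.
by apply/imsetP=> -[[]].
Qed.

(* [f(m, r)] of the introduction; [f(1, 0) = 1] because one point has no pairs. *)
Fixpoint generic_count (m r : nat) : nat :=
  match m, r with
  | 0, _ => 1
  | m'.+1, 0 => m' == 0
  | m'.+1, r'.+1 => generic_count m' r'.+1 + m' * generic_count m' r'
  end.

Lemma generic_countS m r :
  generic_count m.+1 r.+1 = generic_count m r.+1 + m * generic_count m r.
Proof. by []. Qed.

Lemma generic_count_mono m p r : m <= p -> generic_count m r.+1 <= generic_count p r.+1.
Proof.
by elim: p => [|p IHp]; rewrite leq_eqVlt => /orP[/eqP -> //|//]; rewrite ltnS => /IHp le;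
  rewrite generic_countS; apply: leq_trans le (leq_addr _ _).
Qed.

(** Both terms of the recursion are saturated by induction; the common value is [(m + 1)!], all
    orders of [m + 1] points. *)
Lemma generic_count_sat m r : m <= r -> generic_count m.+1 r = generic_count m.+1 m.
Proof.
elim: m r => [|m IHm] [|r] //.
rewrite ltnS => le; rewrite !(generic_countS m.+1) !(IHm _ (leqW le)) IHm //.
by rewrite (IHm m.+1).
Qed.

(** The term multiplied by [m] grows strictly by induction, and the other one does not decrease. *)
Lemma generic_count_ltnS m r : r.+1 < m -> generic_count m r < generic_count m r.+1.
Proof.
elim: m r => // m IHm [|r] lt_r.
  have -> : generic_count m.+1 0 = 0 by case: m lt_r {IHm}.
  by apply: leq_trans (generic_count_mono _ (leq0n m.+1)).
rewrite !generic_countS -addnS leq_add //; last by rewrite ltn_pmul2l ?IHm //; lia.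
have [lt|ge] := ltnP r.+2 m; first exact/ltnW/IHm.
(* At the boundary the first term is already saturated, hence constant. *)
have -> : m = r.+2 by lia.
by rewrite generic_count_sat.
Qed.

Lemma generic_count_ltn m r s : r < s -> s < m -> generic_count m r < generic_count m s.
Proof.
elim: s => // s IHs; rewrite ltnS leq_eqVlt => /orP[/eqP ->|lt_rs] lt_sm.
  exact: generic_count_ltnS.
by apply: ltn_trans (IHs lt_rs (ltnW lt_sm)) (generic_count_ltnS lt_sm).
Qed.

(** The cutoff does not depend on [k], and the terms beyond it vanish because [c(n, j) = 0] for
    [j > n]; so the Stirling recursion applies termwise. *)
Definition stirling_sum (n k : nat) : nat := \sum_(0 <= i < n.+1) 2 * stirling1 n (k + 2 * i).

Lemma stirling_sumE n k N : n < k + 2 * N ->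
  stirling_sum n k = \sum_(0 <= i < N) 2 * stirling1 n (k + 2 * i).
Proof.
move=> ltn; pose F i := 2 * stirling1 n (k + 2 * i).
have F0 a b : n < k + 2 * a -> \sum_(a <= i < b) F i = 0.
  move=> lta; rewrite big_nat big1 // => i /andP[ai _].
  by rewrite /F stirling1_gt ?muln0 //; lia.
have [le|lt] := leqP N n.+1.
  by rewrite /stirling_sum (big_cat_nat _ le) //= (F0 N) ?addn0.
by rewrite (big_cat_nat _ (ltnW lt)) //= (F0 n.+1) ?addn0 //; lia.
Qed.

Lemma stirling_sum_rec n k :
  stirling_sum n.+1 k.+1 = stirling_sum n k + n * stirling_sum n k.+1.
Proof.
rewrite (stirling_sumE (N := n.+2)); last lia.
rewrite [stirling_sum n k](stirling_sumE (N := n.+2)); last lia.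
rewrite [stirling_sum n k.+1](stirling_sumE (N := n.+2)); last lia.
rewrite big_distrr -big_split /=; apply: eq_bigr => i _.
by rewrite addSn stirling1_rec; lia.
Qed.

Lemma stirling_sum_0 n : stirling_sum n.+1 0 = stirling_sum n.+1 2.
Proof.
rewrite (stirling_sumE (N := n.+3)); last lia.
rewrite [RHS](stirling_sumE (N := n.+2)); last lia.
rewrite big_nat_recl // muln0 stirling1_0 muln0 add0n.
by apply: eq_bigr => i _; congr (2 * stirling1 _ _); lia.
Qed.

(** Both sides obey the same recursion. It starts at two points because the formula fails for one:
    [generic_count 1 0] is 1, the sum is 0. *)
Lemma generic_count_stirling n r : r <= n.+2 ->
  generic_count n.+2 r = stirling_sum n.+2 (n.+3 - r).
Proof.
elim: n r => [|n IHn] r le_r.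
  have c1 : stirling1 2 1 = 1 by rewrite stirling1_rec stirling1_diag stirling1_0.
  have c2 := stirling1_diag 2.
  rewrite /stirling_sum !big_nat_recr //= big_geq //.
  by case: r le_r => [|[|[|]]] //= _; rewrite ?c1 ?c2 ?stirling1_gt.
case: r le_r => [|r] le_r.
  by rewrite /stirling_sum big1 // => i _; rewrite stirling1_gt //; lia.
rewrite ltnS in le_r; rewrite generic_countS (IHn r) //.
have -> : n.+4 - r.+1 = (n.+2 - r).+1 by lia.
rewrite stirling_sum_rec -subSn //; congr (_ + _).
(* Here the Stirling index drops to 0 and [r.+1] leaves the range of the induction; saturation on
   one side and [c(n + 2, 0) = 0] on the other close the gap. *)
have [->|neq] := eqVneq r n.+2.
  rewrite subnn stirling_sum_0 (generic_count_sat (leqW (leqnSn n.+1))).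
  by rewrite IHn //; congr stirling_sum; lia.
by rewrite IHn ?subSS //; lia.
Qed.

Lemma generic_count_bound n r : 0 < r < n -> generic_count n r = sweep_bound n r.
Proof.
case: n => [|[|n]]; rewrite ?ltnS => /andP[r0 rn]; [by []| lia |].
rewrite generic_count_stirling; last lia.
rewrite (stirling_sumE (N := ((r - 1) %/ 2).+1)); last lia.
by apply: eq_bigr => i _; congr (2 * stirling1 _ _); lia.
Qed.

(** * Oriented matroids of weak orders *)

Definition cmp_sign (a b : nat) : sign :=
  if a < b then Plus else if b < a then Minus else Zero.

Lemma cmp_sign_eq0 a b : (cmp_sign a b == Zero) = (a == b).
Proof. by rewrite /cmp_sign; case: ltngtP. Qed.

Lemma cmp_sign_opp a b : cmp_sign a b = opp_sign (cmp_sign b a).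
Proof. by rewrite /cmp_sign; case: ltngtP. Qed.

Lemma cmp_sign_xx a : cmp_sign a a = Zero.
Proof. by apply/eqP; rewrite cmp_sign_eq0. Qed.

Section WeakOrders.
Variable n : nat.
Implicit Types (X Y : signvec (pairs n)) (L : {set signvec (pairs n)}) (J : {set 'I_n}).
Implicit Types (m : 'I_n) (p q : 'I_n -> nat) (e f : pairs n).

Definition ordered_by p X : Prop := forall e, X e = cmp_sign (p (val e).1) (p (val e).2).

(** Arbitrary heights replace block indices; the counting uses only the order they induce. *)
Definition weak_orders L : Prop := forall X, X \in L -> exists p, ordered_by p X.

Definition mkpair (i j : 'I_n) (ltij : i < j) : pairs n :=
  exist (fun ij : 'I_n * 'I_n => ij.1 < ij.2) (i, j) ltij.

Lemma pair_inj e f : (val e).1 = (val f).1 -> (val e).2 = (val f).2 -> e = f.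
Proof. by move=> eq1 eq2; apply: val_inj; case: (val e) (val f) eq1 eq2 => ? ? [? ?] /= -> ->. Qed.

Lemma pair_lt e : (val e).1 < (val e).2.
Proof. exact: (valP e). Qed.

Lemma sweep_weak_orders L : sweep_oriented_matroid L -> weak_orders L.
Proof.
by case=> _ h X /h[I _ ->]; exists (block_index I) => e; rewrite ffunE.
Qed.

Lemma weak_orders_sub L L' : L' \subset L -> weak_orders L -> weak_orders L'.
Proof. by move=> /subsetP sL h X /sL; apply: h. Qed.

Definition inner J : {set pairs n} := [set e | ((val e).1 \in J) && ((val e).2 \in J)].

Definition star m J : {set pairs n} := [set e | ((val e).1 \in J) && ((val e).2 == m)].

Lemma inner_max J m : m \in J -> {in J, forall i : 'I_n, i <= m} ->
  inner J = inner (J :\ m) :|: star m (J :\ m).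
Proof.
move=> mJ maxm; apply/setP=> e; rewrite !inE.
case e1J: (_.1 \in J); rewrite ?andbF //= andbT.
have -> : (val e).2 \in J = ((val e).2 == m) || ((val e).2 \in J).
  by case: eqP => // ->; rewrite mJ.
case: eqP => [e2|_] /=; case: eqP => //= e1; last by rewrite orbF.
  by have := pair_lt e; rewrite e1 e2 ltnn.
case e2J: (_.2 \in J) => //.
by have := maxm _ e2J; rewrite leqNgt -{1}e1 pair_lt.
Qed.

Lemma card_star J m : {in J, forall i : 'I_n, i < m} -> #|star m J| = #|J|.
Proof.
move=> ltm; suff eqJ : [set (val e).1 | e in star m J] = J.
  rewrite -[in RHS]eqJ card_in_imset // => e f; rewrite !inE => /andP[_ /eqP e2] /andP[_ /eqP f2] ef.
  by apply: pair_inj ef _; rewrite e2 f2.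
apply/setP=> i; apply/imsetP/idP => [[e + ->]|iJ]; first by rewrite inE => /andP[].
by exists (mkpair (ltm _ iJ)); rewrite ?inE //= iJ eqxx.
Qed.

Lemma max_ltn J m : {in J, forall i : 'I_n, i <= m} -> {in J :\ m, forall i : 'I_n, i < m}.
Proof.
move=> maxm i /setD1P[im iJ]; rewrite ltn_neqAle maxm // andbT.
by rewrite val_eqE.
Qed.

(** Contracting [(k, m)] ties [m] to [k], so [(i, m)] agrees with [(i, k)] when [i < k] and is
    opposite to [(k, i)] when [k < i]: the star satisfies the hypothesis of [num_full_setU]. *)
Lemma num_full_inner L J m : oriented_matroid L -> weak_orders L ->
  m \in J -> {in J, forall i : 'I_n, i <= m} ->
  {in star m (J :\ m), forall e, exists2 X, X \in L & X e != Zero} ->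
  num_full L (inner J) = num_full L (inner (J :\ m)) +
    \sum_(e in star m (J :\ m)) num_full (contract L [set e]) (inner (J :\ m)).
Proof.
move=> omL woL mJ maxm nl; rewrite (inner_max mJ maxm); apply: num_full_setU => //.
  move=> e eS; split; last exact: nl.
  by move: eS; rewrite !inE => /andP[_ /eqP ->]; rewrite eqxx andbF.
move=> e f; rewrite inE => /andP[e1 /eqP e2]; rewrite inE => /andP[f1 /eqP f2] neq.
have ord X : X \in contract L [set e] ->
    exists p, ordered_by p X /\ p m = p (val e).1.
  move=> /contract1P[/woL[p pX] Xe]; exists p; split=> //.
  by move: Xe; rewrite pX => /eqP; rewrite cmp_sign_eq0 e2 => /eqP ->.
case: (ltngtP (val f).1 (val e).1) => [lt|lt|eq].
- exists (mkpair lt); first by rewrite inE e1 f1.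
  by left=> X /ord[p [pX pm]]; rewrite !pX /= f2 pm.
- exists (mkpair lt); first by rewrite inE e1 f1.
  by right=> X /ord[p [pX pm]]; rewrite !pX /= f2 pm cmp_sign_opp.
- by case/eqP: neq; apply: pair_inj; [apply: val_inj | rewrite e2 f2].
Qed.

Lemma inner0 : inner set0 = set0.
Proof. by apply/setP=> e; rewrite !inE. Qed.

Lemma num_full0 L : L != set0 -> num_full L set0 = 1.
Proof.
case/set0Pn=> X XL; apply/eqP/cards1P; exists (sv0 (pairs n)).
have r0 Y : restr set0 Y = sv0 (pairs n) by apply/ffunP=> e; rewrite !ffunE inE.
apply/setP=> Y; rewrite inE; apply/imsetP/eqP => [[Z _ ->]|->]; first exact: r0.
by exists X; rewrite ?r0 // inE XL; apply/fullP=> e; rewrite inE.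
Qed.

Lemma oriented_matroid_neq0 L : oriented_matroid L -> L != set0.
Proof. by case=> L0 _ _ _; apply/set0Pn; exists (sv0 (pairs n)). Qed.

Lemma num_full_loop L (A : {set pairs n}) e : e \in A -> (forall X, X \in L -> X e = Zero) ->
  num_full L A = 0.
Proof.
move=> eA loop; apply/eqP; rewrite cards_eq0; apply/eqP/setP=> Y; rewrite inE.
apply/imsetP=> -[X]; rewrite inE => /andP[/loop Xe /fullP/(_ e eA)].
by rewrite Xe.
Qed.

Lemma exists_max J : 0 < #|J| ->
  exists m, [/\ m \in J, {in J, forall i : 'I_n, i <= m} & #|J| = #|J :\ m|.+1].
Proof.
case/card_gt0P=> i0 i0J; exists [arg max_(i > i0 in J) (i : nat)].
by case: arg_maxnP => //= m mJ maxm; split=> //; rewrite (cardsD1 m) mJ.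
Qed.

(** Induction on [#|J|], removing the largest point. Bounding chains directly lets [chain_contract]
    pass the bound on to contractions. *)
Lemma num_full_leq L J r : oriented_matroid L -> weak_orders L ->
  (forall C, chain L C -> #|C| <= r.+1) ->
  num_full L (inner J) <= generic_count #|J| r.
Proof.
have [c] := ubnP #|J|; elim: c => // c IHc in L J r *; rewrite ltnS => ltc omL woL chL.
have [J0|] := posnP #|J|.
  by rewrite J0 (cards0_eq J0) inner0 num_full0 ?oriented_matroid_neq0.
case/exists_max=> m [mJ maxm cJ]; rewrite cJ in ltc *.
have cS := card_star (max_ltn maxm).
(* A loop in the star makes the count zero; otherwise every pair of the star can be contracted. *)
have [/exists_inP[e eS /forall_inP loop]|/exists_inPn nl] :=
    boolP [exists e in star m (J :\ m), [forall X in L, X e == Zero]].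
  rewrite (@num_full_loop _ _ e) // => [|X XL]; last exact/eqP/loop.
  by rewrite (inner_max mJ maxm) inE eS orbT.
have {}nl : {in star m (J :\ m), forall e, exists2 X, X \in L & X e != Zero}.
  by move=> e /nl/forall_inPn.
rewrite (num_full_inner omL woL mJ maxm nl).
have chS e r' : e \in star m (J :\ m) -> r = r'.+1 ->
    forall C, chain (contract L [set e]) C -> #|C| <= r'.+1.
  move=> eS eqr C /(chain_contract omL (nl _ eS))[C' /chL + cC'].
  by rewrite cC' eqr.
(* For [r = 0] a nonloop in the star would give a chain of two covectors, so the star is empty and
   [J] has one point. *)
case: r => [|r] in chL chS *.
  have S0 : star m (J :\ m) = set0.
    apply/setP=> e; rewrite [RHS]inE; apply/negP=> eS.
    have ch0 : chain (contract L [set e]) [set sv0 (pairs n)].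
      apply/chainP; split; last first.
        by move=> X Y /set1P -> /set1P ->; rewrite orbb; apply/sv_leP.
      rewrite sub1set; apply/contract1P; split; last by rewrite ffunE.
      by case: omL.
    have [C' /chL] := chain_contract omL (nl _ eS) ch0.
    by rewrite cards1 => + eqC; rewrite eqC.
  have J0 : #|J :\ m| = 0 by rewrite -cS S0 cards0.
  by rewrite S0 big_set0 addn0 J0 (cards0_eq J0) inner0 num_full0 ?oriented_matroid_neq0.
rewrite generic_countS leq_add ?IHc //.
rewrite -[X in X * _]cS -sum_nat_const leq_sum // => e eS.
apply: IHc => //; first exact: oriented_matroid_contract.
  exact: weak_orders_sub (contract_sub _ _) woL.
exact: chS.
Qed.

(* Only the forests arising in the deletion-contraction recursion matter:
   those in which every point is joined to at most one smaller point. *)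
Definition increasing_forest (Z : {set pairs n}) : Prop :=
  {in Z &, injective (fun e => (val e).2)}.

(** Independence of the forest in the underlying matroid, in the form the recursion consumes: an
    edge stays a nonloop once the others are contracted. *)
Definition free_on_forests L (d : nat) : Prop :=
  forall Z, increasing_forest Z -> #|Z| <= d ->
  forall e, e \in Z -> exists2 X, X \in contract L (Z :\ e) & X e != Zero.

(** [Z] holds the edges contracted so far. Their larger ends have left [J], so adding an edge that
    ends at the maximum of [J] keeps the forest increasing, and freeness makes that edge a
    nonloop. *)
Lemma num_full_geq L J Z d : oriented_matroid L -> weak_orders L ->
  free_on_forests L d -> increasing_forest Z -> #|Z| <= d ->
  {in Z, forall e, (val e).2 \notin J} ->
  generic_count #|J| (d - #|Z|) <= num_full (contract L Z) (inner J).
Proof.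
move=> omL woL free; have [c] := ubnP #|J|.
elim: c => // c IHc in J Z *; rewrite ltnS => ltc forZ leZ ZJ.
have omZ := oriented_matroid_contract Z omL.
have [J0|] := posnP #|J|.
  by rewrite J0 (cards0_eq J0) inner0 num_full0 ?oriented_matroid_neq0.
case/exists_max=> m [mJ maxm cJ]; rewrite cJ in ltc *.
have cS := card_star (max_ltn maxm).
have ZJm : {in Z, forall e, (val e).2 \notin J :\ m}.
  by move=> e /ZJ; apply: contra; rewrite inE => /andP[].
case eqr: (d - #|Z|) => [|r].
  rewrite [generic_count _ _]/=; case: eqP => // Jm0.
  have S0 : star m (J :\ m) = set0 by apply: cards0_eq; rewrite cS.
  by rewrite (inner_max mJ maxm) S0 setU0 (cards0_eq Jm0) inner0 num_full0 ?oriented_matroid_neq0.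
have ltZ : #|Z| < d by rewrite -subn_gt0 eqr.
have hS e : e \in star m (J :\ m) ->
    [/\ e \notin Z, increasing_forest (e |: Z) & #|e |: Z| = #|Z|.+1].
  rewrite inE => /andP[_ /eqP e2].
  have eZ f : f \in Z -> (val f).2 != (val e).2.
    by move/ZJ; apply: contra => /eqP ->; rewrite e2.
  have eNZ : e \notin Z by apply/negP=> /eZ; rewrite eqxx.
  split=> //; last by rewrite cardsU1 eNZ.
  move=> f g /setU1P[->|fZ] /setU1P[->|gZ] //; last exact: forZ.
    by move=> eq2; case/eqP: (eZ _ gZ).
  by move=> eq2; case/eqP: (eZ _ fZ).
rewrite (num_full_inner omZ _ mJ maxm); first last.
- move=> e /hS[eZ forZ' cZ']; have := free _ forZ' _ e (setU11 _ _).
  by rewrite setU1K // cZ'; apply.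
- exact: weak_orders_sub (contract_sub _ _) woL.
rewrite generic_countS leq_add //; first by rewrite -eqr IHc.
rewrite -[X in X * _]cS -sum_nat_const leq_sum // => e eS; have [eZ forZ' cZ'] := hS _ eS.
rewrite contractU1; have -> : r = d - #|e |: Z| by rewrite cZ' subnS eqr.
apply: IHc; rewrite ?cZ' //.
move=> f /setU1P[->|/ZJm //].
by move: eS; rewrite !inE => /andP[_ /eqP ->]; rewrite eqxx.
Qed.

(* The rank of a weak order is its number of classes minus one; classes are
   counted by their minima. *)
Lemma weak_orders_rank L : weak_orders L -> rank L <= n.-1.
Proof.
(* [U X] consists of the class minima other than point 0, so it has at most [n.-1] elements. *)
move=> woL; pose U X := [set j : 'I_n | (0 < j) && [forall e, ((val e).2 == j) ==> (X e != Zero)]].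
apply: (@rank_leq_height _ _ _ (fun X => #|U X|)) => [X Y XL YL /sv_leP le neq|X _]; last first.
  have [->|[i _]] := set_0Vmem (U X); first by rewrite cards0.
  pose i0 := Ordinal (leq_ltn_trans (leq0n i) (ltn_ord i)).
  apply: leq_trans (subset_leq_card (_ : U X \subset [set~ i0])) _.
    by apply/subsetP=> j; rewrite !inE => /andP[j0 _]; rewrite -val_eqE /= -lt0n.
  by rewrite cardsC1 card_ord.
have [p pX] := woL _ XL; have [q qY] := woL _ YL.
pose D e := (X e == Zero) && (Y e != Zero).
have [e0 De0] : exists e, D e.
  apply/existsP; apply: contraR neq => /existsPn noD; apply/eqP/ffunP=> e.
  have := noD e; rewrite /D; case: eqP => [->|/eqP /le -> //].
  by case: eqP => // ->.
(* Among the pairs tied in [X] but not in [Y], take one with the least larger end; that end is a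
   class minimum for [Y] but not for [X]. *)
case: (@arg_minnP _ e0 D (fun e => (val e).2)) => // e /andP[/eqP Xe Ye] mine.
have eX : p (val e).1 = p (val e).2 by apply/eqP; rewrite -cmp_sign_eq0 -pX Xe.
have eY : q (val e).1 != q (val e).2 by rewrite -cmp_sign_eq0 -qY.
apply: proper_card; apply/properP; split.
  apply/subsetP=> j; rewrite !inE => /andP[-> /forallP h]; apply/forallP=> f.
  by apply/implyP=> /(implyP (h f)) Xf; rewrite le.
exists (val e).2; last first.
  by rewrite !inE negb_and negb_forall; apply/orP; right; apply/existsP; exists e; rewrite eqxx Xe.
rewrite inE (leq_ltn_trans _ (pair_lt e)) //=; apply/forallP=> f; apply/implyP=> /eqP ef.
apply/negP=> /eqP Yf.
have fY : q (val f).1 = q (val e).2 by apply/eqP; rewrite -ef -cmp_sign_eq0 -qY Yf.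
have fX : p (val f).1 = p (val e).2.
  apply/eqP; rewrite -ef -cmp_sign_eq0 -pX; apply/negPn/negP=> Xf.
  by have := Xf; rewrite -(le _ Xf) Yf.
(* If a smaller point were tied to [(val e).2] in [Y], it would form with [(val e).1] a pair tied in
   [X] only, with a lesser larger end. *)
case: (ltngtP (val e).1 (val f).1) => [lt|lt|/val_inj eq].
- have /mine : D (mkpair lt).
    by rewrite /D pX qY /= !cmp_sign_eq0 eX fX fY eqxx.
  by rewrite /= leqNgt -ef pair_lt.
- have /mine : D (mkpair lt).
    by rewrite /D pX qY /= !cmp_sign_eq0 eX fX fY eqxx eq_sym.
  by rewrite /= leqNgt pair_lt.
- by rewrite eq fY eqxx in eY.
Qed.

(** * Topes and permutations *)

Lemma perm_partition_sign (s : 'S_n) :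
  ordered_by (fun i => (s^-1)%g i) (partition_signvec (perm_partition s)).
Proof.
have idx i : block_index (perm_partition s) i = (s^-1)%g i.
  rewrite /block_index /perm_partition find_map -[RHS]index_enum_ord.
  apply: eq_find => k; rewrite /= inE.
  by apply/eqP/eqP=> ->; rewrite ?permK ?permKV.
by move=> e; rewrite ffunE /= !idx.
Qed.

(** Induction on the position [t i], comparing with the point one position earlier. Used in both
    directions, it shows that a permutation is determined by the order it induces. *)
Lemma perm_order_leq (t t' : 'S_n) :
  (forall i j, t i < t j -> t' i < t' j) -> forall i, t i <= t' i.
Proof.
move=> mono i; have [c] := ubnP (t i); elim: c => // c IHc in i *; rewrite ltnS => le.
case ti: (val (t i)) => [|b] //.
have ltb : b < n by rewrite (leq_ltn_trans _ (ltn_ord (t i))) // ti.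
pose j := (t^-1)%g (Ordinal ltb).
have tj : t j = Ordinal ltb by rewrite permKV.
apply: leq_ltn_trans (mono j i _); last by rewrite tj ti.
by have := IHc j; rewrite tj /=; apply; rewrite -ti.
Qed.

Lemma ordered_by_ltn p q X i j : ordered_by p X -> ordered_by q X ->
  p i < p j -> q i < q j.
Proof.
move=> pX qX ltp; case: (ltngtP i j) => [lt|lt|eqij].
- by have := pX (mkpair lt); rewrite qX /cmp_sign /= ltp; case: (ltngtP (q i)).
- have := pX (mkpair lt); rewrite qX /cmp_sign /= ltp (ltnNge (p j)) (ltnW ltp).
  by case: (ltngtP (q j)).
- by rewrite (val_inj eqij) ltnn in ltp.
Qed.

Lemma partition_signvec_inj :
  injective (fun s : 'S_n => partition_signvec (perm_partition s)).
Proof.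
move=> s s' eqX; apply: invg_inj; apply/permP=> i; apply/val_inj/anti_leq.
have h := perm_partition_sign s; have h' := perm_partition_sign s'.
rewrite /= -eqX in h'.
apply/andP; split; apply: perm_order_leq => k l; first exact: (ordered_by_ltn h h').
exact: (ordered_by_ltn h' h).
Qed.

(** Without zeros the heights are distinct, and counting the points below each one turns them into
    positions. *)
Lemma full_perm X : full setT X -> (exists p, ordered_by p X) ->
  exists s : 'S_n, X = partition_signvec (perm_partition s).
Proof.
move=> /fullP fX [p pX].
have p_inj : injective p.
  move=> i j eqp; case: (ltngtP i j) => [lt|lt|/val_inj //].
    by have := fX (mkpair lt) (in_setT _); rewrite pX /= eqp cmp_sign_xx.
  by have := fX (mkpair lt) (in_setT _); rewrite pX /= eqp cmp_sign_xx.
pose below i := [set j | p j < p i].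
have lt_below i : #|below i| < n.
  rewrite -[n in X in _ < X](card_ord n) -cardsT; apply: proper_card.
  by apply/properP; split; [exact: subsetT | exists i; rewrite ?inE ?ltnn].
have mono i j : p i < p j -> #|below i| < #|below j|.
  move=> lt; apply: proper_card; apply/properP; split.
    by apply/subsetP=> k; rewrite !inE => /ltn_trans; apply.
  by exists i; rewrite !inE ?ltnn.
pose t i := Ordinal (lt_below i).
have t_inj : injective t.
  move=> i j /(congr1 val) /= eqt; apply: p_inj.
  by case: (ltngtP (p i) (p j)) => // /mono; rewrite eqt ltnn.
exists (perm t_inj)^-1%g; apply/ffunP=> e.
rewrite (perm_partition_sign _ e) pX invgK !permE /cmp_sign.
case: (ltngtP (p _) (p _)) => [/mono|/mono|eqp] /=; last first.
- by have := pair_lt e; rewrite (p_inj _ _ eqp) ltnn.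
- by case: ltngtP.
- by case: ltngtP.
Qed.

Lemma card_full L : num_full L setT = #|[set X in L | full setT X]|.
Proof.
rewrite /num_full (eq_in_imset (g := id)) ?imset_id // => X _.
by apply/ffunP=> e; rewrite ffunE inE.
Qed.

(** A covector without zeros is a tope and comes from exactly one permutation. If there are loops,
    both sides are 0. *)
Lemma card_sweep_permutations L : weak_orders L ->
  #|sweep_permutations L| = num_full L setT.
Proof.
move=> woL; rewrite card_full -(card_imset _ partition_signvec_inj).
apply: eq_card => X; rewrite inE; apply/imsetP/andP => [[s + ->]|[XL fX]].
  rewrite inE => sT; split; first by move: sT; rewrite inE => /andP[].
  apply/fullP=> e _; rewrite perm_partition_sign cmp_sign_eq0.
  by rewrite val_eqE (inj_eq perm_inj) -val_eqE neq_ltn pair_lt.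
have [s eqX] := full_perm fX (woL _ XL).
by exists s => //; rewrite inE -eqX full_topes.
Qed.

Lemma card_topes_loopless L : oriented_matroid L -> loopless L ->
  #|topes L| = num_full L setT.
Proof.
move=> omL ll; rewrite card_full; apply: eq_card => X; rewrite [RHS]inE.
apply/idP/andP => [XT|[XL fX]]; last exact: full_topes.
split; first by move: XT; rewrite inE => /andP[].
by apply/fullP=> e _; apply: topes_full XT _ (ll e).
Qed.

(* Loops join points that are never separated; keep one point of each class. *)
Lemma card_topes_leq L : oriented_matroid L -> weak_orders L ->
  exists J, #|topes L| <= num_full L (inner J).
Proof.
move=> omL woL.
pose J := [set j | [forall e, ((val e).2 == j) ==> [exists X in L, X e != Zero]]].
exists J.
have repJ j : exists2 j', j' \in J &
    forall X p, X \in L -> ordered_by p X -> p j' = p j.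
  have [c] := ubnP (val j); elim: c => // c IHc in j *; rewrite ltnS => le.
  have [jJ|] := boolP (j \in J); first by exists j.
  rewrite inE => /forallPn[e]; rewrite negb_imply => /andP[/eqP e2 /exists_inPn loop].
  have [|i iJ hi] := IHc (val e).1; first by rewrite (leq_trans _ le) // -e2 pair_lt.
  exists i => // X p XL pX; rewrite (hi _ _ XL pX) -e2.
  by apply/eqP; rewrite -cmp_sign_eq0 -pX; apply/negPn/loop.
have topL X : X \in topes L -> X \in L by rewrite inE => /andP[].
rewrite /num_full -(card_in_imset (f := restr (inner J)) (D := topes L)).
  apply/subset_leq_card/subsetP=> _ /imsetP[X XT ->].
  rewrite imset_f // inE topL //; apply/fullP=> e; rewrite !inE => /andP[_ /forallP/(_ e)].
  by rewrite eqxx => /exists_inP/(topes_full omL XT).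
move=> X Y /topL XL /topL YL /restrP eqXY; apply/ffunP=> e.
have [p pX] := woL _ XL; have [q qY] := woL _ YL.
have [i iJ hi] := repJ (val e).1; have [j jJ hj] := repJ (val e).2.
rewrite pX qY -(hi _ _ XL pX) -(hj _ _ XL pX) -(hi _ _ YL qY) -(hj _ _ YL qY).
case: (ltngtP i j) => [lt|lt|/val_inj ->]; last by rewrite !cmp_sign_xx.
  by have := eqXY (mkpair lt); rewrite inE pX qY /= iJ jJ; apply.
rewrite cmp_sign_opp [RHS]cmp_sign_opp; congr opp_sign.
by have := eqXY (mkpair lt); rewrite inE pX qY /= iJ jJ; apply.
Qed.

Lemma innerT : inner setT = setT.
Proof. by apply/setP=> e; rewrite !inE. Qed.

Lemma sweep_rank_ltn L : weak_orders L -> 0 < rank L -> rank L < n.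
Proof. by move=> /weak_orders_rank; lia. Qed.

Lemma sweep_count_leq L : oriented_matroid L -> weak_orders L ->
  num_full L setT <= generic_count n (rank L).
Proof.
move=> omL woL; rewrite -innerT.
have := @num_full_leq L setT (rank L) omL woL.
by rewrite cardsT card_ord; apply=> C; apply: chain_leq_rank.
Qed.

(** [J] may be smaller than the point set, so monotonicity in the number of points is needed; it
    fails in rank 0, where [generic_count] drops from 1 to 0. *)
Lemma topes_count_leq L : oriented_matroid L -> weak_orders L -> 0 < rank L ->
  #|topes L| <= generic_count n (rank L).
Proof.
move=> omL woL r0; have [J le] := card_topes_leq omL woL.
apply: leq_trans le _; apply: (@leq_trans (generic_count #|J| (rank L))).
  by apply: num_full_leq => // C; apply: chain_leq_rank.
by case: (rank L) r0 => // r _; rewrite generic_count_mono // -[n in _ <= n]card_ord max_card.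
Qed.

End WeakOrders.

(** * Point configurations *)

(** The blocks are the level sets of [x], listed by increasing value. *)
Lemma exists_ordered_partition (R : realType) (n : nat) (x : 'I_n -> R) :
  exists2 I, ordered_partition I &
    forall i j, (block_index I i < block_index I j)%N = (x i < x j)%R.
Proof.
pose s := sort <=%O (undup (codom x)).
have s_lt : sorted <%O s by rewrite sort_lt_sorted undup_uniq.
have sP v : reflect (exists i, v = x i) (v \in s).
  by rewrite mem_sort mem_undup; apply: codomP.
have xs i : x i \in s by apply/sP; exists i.
pose I := [seq [set i | x i == v] | v <- s].
have IP B : reflect (exists i, B = [set j | x j == x i]) (B \in I).
  by apply: (iffP mapP) => [[_ /sP[i ->] ->]|[i ->]]; [exists i | exists (x i)].
have idx i : block_index I i = index (x i) s.
  by rewrite /block_index find_map; apply: eq_find => v; rewrite /= inE eq_sym.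
exists I.
  rewrite /ordered_partition map_inj_in_uniq ?lt_sorted_uniq //=; last first.
    move=> _ w /sP[i ->] _ /setP/(_ i); rewrite !inE eqxx => /esym/eqP //.
  apply/and3P; split.
  - apply/eqP/setP=> i; rewrite inE; apply/bigcupP.
    by exists [set j | x j == x i]; rewrite inE //; apply/IP; exists i.
  - apply/trivIsetP=> A B; rewrite !inE => /IP[i ->] /IP[j ->] neq.
    rewrite -setI_eq0; apply: contraR neq => /set0Pn[k].
    by rewrite !inE => /andP[/eqP <- /eqP <-].
  - rewrite inE; apply/IP=> -[i /setP/(_ i)]; rewrite !inE eqxx //.
move=> i j; rewrite !idx.
have ltx k l : (index (x k) s < index (x l) s)%N -> (x k < x l)%R.
  exact: (sorted_ltn_index lt_trans s_lt).
case: (ltngtP (index _ _)) => [/ltx -> //|/ltx lt|eqi].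
  by rewrite ltNge (ltW lt).
by rewrite -(nth_index 0%R (xs i)) eqi nth_index // ltxx.
Qed.

(** * The sweep oriented matroid of a configuration *)

Section SweepOM.
Variables (R : realType) (n d : nat).
Implicit Types (a : 'M[R]_(n, d)) (u v : 'rV[R]_d) (e f : pairs n).
Local Open Scope ring_scope.

Definition slope a u e : R := \sum_k u 0 k * (a (val e).2 k - a (val e).1 k).

Lemma slopeD a c c' u v e :
  slope a (c *: u + c' *: v) e = c * slope a u e + c' * slope a v e.
Proof.
rewrite /slope !mulr_sumr -big_split; apply: eq_bigr => k _ /=.
by rewrite !mxE mulrDl !mulrA.
Qed.

Lemma sweep_signvecE a u e : sweep_signvec a u e = sign_of (slope a u e).
Proof. by rewrite ffunE. Qed.

Lemma sweep_omP a X : reflect (exists u, X = sweep_signvec a u) (X \in sweep_om a).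
Proof. by rewrite inE; apply: asboolP. Qed.

Lemma sign_of_eq0 (x : R) : (sign_of x == Zero) = (x == 0).
Proof. by rewrite /sign_of; case: (ltgtP 0 x). Qed.

Lemma sign_of0 : sign_of (0 : R) = Zero.
Proof. by apply/eqP; rewrite sign_of_eq0. Qed.

Lemma sign_ofN (x : R) : sign_of (- x) = opp_sign (sign_of x).
Proof. by rewrite /sign_of oppr_gt0 oppr_lt0; case: (ltgtP 0 x). Qed.

Lemma sign_of_pmul (c x : R) : 0 < c -> sign_of (c * x) = sign_of x.
Proof. by move=> c0; rewrite /sign_of pmulr_rgt0 // pmulr_rlt0. Qed.

Lemma sign_of_addl (x y : R) : `|y| < `|x| -> sign_of (x + y) = sign_of x.
Proof.
rewrite /sign_of; case: (ltgtP 0 x) => [x0|x0|<-]; last by rewrite normr0 ltNge normr_ge0.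
  by rewrite (gtr0_norm x0) ltr_norml => /andP[h _]; rewrite addrC -ltrBlDr sub0r h.
rewrite (ltr0_norm x0) ltr_norml opprK => /andP[_ h].
have xy : x + y < 0 by rewrite addrC -ltrBrDr sub0r.
by rewrite ltNge (ltW xy) xy.
Qed.

Lemma sign_of_addr (x y : R) : sign_of y != opp_sign (sign_of x) ->
  sign_of x != Zero -> sign_of (x + y) = sign_of x.
Proof.
rewrite /sign_of; case: (ltgtP 0 x) => // x0; case: (ltgtP 0 y) => [y0|y0|<-] // _ _;
  rewrite ?addr0.
- by rewrite addr_gt0.
- by rewrite x0.
- have xy : x + y < 0 by rewrite addrC ltr_wnDl // ltW.
  by rewrite ltNge (ltW xy) xy.
- by rewrite ltNge (ltW x0) x0.
Qed.

Lemma oriented_matroid_sweep_om a : oriented_matroid (sweep_om a).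
Proof.
split.
- apply/sweep_omP; exists 0; apply/ffunP=> e; rewrite sweep_signvecE ffunE.
  by rewrite /slope big1 ?sign_of0 // => k _; rewrite mxE mul0r.
- move=> _ /sweep_omP[u ->]; apply/sweep_omP; exists (- u); apply/ffunP=> e.
  rewrite [sv_opp _ _]ffunE !sweep_signvecE -sign_ofN /slope -sumrN; congr sign_of.
  by apply: eq_bigr => k _; rewrite mxE mulNr.
- move=> _ _ /sweep_omP[u ->] /sweep_omP[v ->]; apply/sweep_omP.
  (* [M] exceeds every ratio of slopes, so [M u + v] has the sign of [u] wherever that is nonzero; a
     zero denominator contributes 0. *)
  pose M := 1 + \sum_f `|slope a v f| / `|slope a u f|.
  have M0 : 0 < M by rewrite ltr_pwDl // sumr_ge0 // => f _; rewrite divr_ge0.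
  exists (M *: u + 1 *: v); apply/ffunP=> e.
  rewrite [sv_comp _ _ _]ffunE !sweep_signvecE slopeD mul1r sign_of_eq0.
  case: eqVneq => [->|ue]; first by rewrite mulr0 add0r.
  rewrite -[in LHS](sign_of_pmul (slope a u e) M0) sign_of_addl // normrM (gtr0_norm M0).
  rewrite -ltr_pdivrMr ?normr_gt0 // /M (bigD1 e) //= addrCA ltrDl.
  by rewrite ltr_pwDl // sumr_ge0 // => f _; rewrite divr_ge0.
- move=> _ _ e /sweep_omP[u ->] /sweep_omP[v ->].
  rewrite /separates !sweep_signvecE sign_of_eq0 => /andP[ue /eqP eqv].
  have ve : slope a v e != 0 by rewrite -sign_of_eq0 eqv opp_sign_eq0 sign_of_eq0.
  (* With these weights the two opposite slopes at [e] cancel. *)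
  set c := `|slope a v e|; set c' := `|slope a u e|.
  have c0 : 0 < c by rewrite normr_gt0.
  have c'0 : 0 < c' by rewrite normr_gt0.
  exists (sweep_signvec a (c *: u + c' *: v)); split.
  + by apply/sweep_omP; exists (c *: u + c' *: v).
  + rewrite sweep_signvecE slopeD /c /c'.
    move: ue ve eqv; rewrite /sign_of.
    case: (ltgtP 0 (slope a u e)) => // hu; case: (ltgtP 0 (slope a v e)) => // hv _ _ _;
      rewrite ?(gtr0_norm hu) ?(ltr0_norm hu) ?(gtr0_norm hv) ?(ltr0_norm hv).
      by rewrite mulNr mulrC addNr ltxx.
    by rewrite mulNr mulrC addrN ltxx.
  + move=> f; rewrite [sv_comp _ _ _]ffunE !sweep_signvecE slopeD sign_of_eq0 => nsep.
    have [uf|uf] := eqVneq (slope a u f) 0; first by rewrite uf mulr0 add0r sign_of_pmul.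
    rewrite uf /= in nsep.
    by rewrite sign_of_addr !sign_of_pmul // sign_of_eq0.
Qed.

Lemma sweep_om_sweep a : sweep_oriented_matroid (sweep_om a).
Proof.
split; first exact: oriented_matroid_sweep_om.
move=> _ /sweep_omP[u ->].
have [I partI ltI] := exists_ordered_partition (fun i => \sum_k u 0 k * a i k).
exists I => //; apply/ffunP=> e; rewrite sweep_signvecE ffunE /= !ltI /sign_of.
have -> : slope a u e = \sum_k u 0 k * a (val e).2 k - \sum_k u 0 k * a (val e).1 k.
  by rewrite -sumrB; apply: eq_bigr => k _; rewrite mulrBr.
by rewrite subr_gt0 subr_lt0.
Qed.

(* The zeros of a covector span a flat; going up a chain of covectors, these
   flats strictly decrease. *)
Lemma rank_sweep_om a : (rank (sweep_om a) <= d)%N.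
Proof.
pose K X : 'M[R]_(#|{: pairs n}|, d) := \matrix_(r, k)
  (if X (enum_val r) == Zero then a (val (enum_val r)).2 k - a (val (enum_val r)).1 k else 0).
apply: (@rank_leq_height _ _ _ (fun X => d - \rank (K X))%N) => [X Y XL|]; last first.
  by move=> X _; rewrite leq_subr.
move=> /sweep_omP[u eqY] /sv_leP le neq.
have sK : (K Y <= K X)%MS.
  apply/row_subP=> r; have [Yr|Yr] := eqVneq (Y (enum_val r)) Zero; last first.
    rewrite (_ : row r _ = 0) ?sub0mx //; apply/rowP=> k.
    by rewrite !mxE (negbTE Yr).
  rewrite (_ : row r _ = row r (K X)) ?row_sub //; apply/rowP=> k; rewrite !mxE Yr eqxx.
  by case: eqVneq => // Xr; have := Xr; rewrite -(le _ Xr) Yr.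
suff ltK : (\rank (K Y) < \rank (K X))%N by rewrite ltn_sub2l // (leq_trans ltK) ?rank_leq_col.
rewrite ltn_neqAle mxrankS // andbT (mxrank_leqif_sup sK).
apply: contra neq => /submxP[D eqK]; apply/eqP/ffunP=> e.
(* With equal ranks, the direction [u] of [Y] annihilates [K X] as well as [K Y], so [Y] vanishes
   wherever [X] does and the two coincide. *)
have KY : K Y *m u^T = 0.
  apply/colP=> r; rewrite !mxE.
  have [Yr|Yr] := eqVneq (Y (enum_val r)) Zero; last first.
    by rewrite big1 // => k _; rewrite !mxE (negbTE Yr) mul0r.
  have /eqP : sign_of (slope a u (enum_val r)) = Zero by rewrite -sweep_signvecE -eqY.
  rewrite sign_of_eq0 => /eqP eq0; rewrite -[RHS]eq0; apply: eq_bigr => k _.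
  by rewrite !mxE Yr eqxx mulrC.
have [Xe|/le -> //] := eqVneq (X e) Zero; rewrite Xe eqY sweep_signvecE.
apply/esym/eqP; rewrite sign_of_eq0.
have /colP/(_ (enum_rank e)) : K X *m u^T = 0 by rewrite eqK -mulmxA KY mulmx0.
rewrite !mxE => eq0; apply/eqP; rewrite -[RHS]eq0; apply: eq_bigr => k _.
by rewrite !mxE enum_rankK Xe eqxx mulrC.
Qed.

End SweepOM.

(** * Generic configurations *)

Section Generic.
Variables (R : realType) (n d : nat).
Local Open Scope ring_scope.

(** The edge vectors cut to their first [#|Z|] coordinates: a nonzero determinant certifies
    independence when [#|Z| <= d]. The ring is general so that the entries can also be
    polynomials. *)
Definition forest_mx (S : comNzRingType) (a : 'M[S]_(n, d)) (Z : {set pairs n}) :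
    'M[S]_#|Z| :=
  (\matrix_(i < #|Z|, k < d) (a (val (enum_val i)).2 k - a (val (enum_val i)).1 k))
    *m pid_mx #|Z|.

Lemma map_forest_mx (S S' : comNzRingType) (g : {rmorphism S -> S'}) a Z :
  map_mx g (forest_mx a Z) = forest_mx (map_mx g a) Z.
Proof.
rewrite /forest_mx map_mxM map_pid_mx; congr (_ *m _).
by apply/matrixP=> i k; rewrite !mxE rmorphB.
Qed.

Lemma free_on_forests_sweep_om (a : 'M[R]_(n, d)) :
  (forall Z, increasing_forest Z -> (#|Z| <= d)%N -> \det (forest_mx a Z) != 0) ->
  free_on_forests (sweep_om a) d.
Proof.
move=> indep Z forZ leZ e eZ.
have uM : forest_mx a Z \in unitmx by rewrite unitmxE unitfE indep.
(* [u] is the dual vector of [e]: slope 1 on [e], slope 0 on the other edges. *)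
pose w : 'cV[R]_#|Z| := delta_mx (enum_rank_in eZ e) 0.
pose u : 'rV[R]_d := (pid_mx #|Z| *m (invmx (forest_mx a Z) *m w))^T.
have slopeu f : f \in Z -> slope a u f = (f == e)%:R.
  move=> fZ; pose D := \matrix_(i < #|Z|, k < d)
    (a (val (enum_val i)).2 k - a (val (enum_val i)).1 k).
  have /colP/(_ (enum_rank_in eZ f)) : D *m u^T = w by rewrite trmxK !mulmxA mulmxV // mul1mx.
  rewrite !mxE eqxx andbT => eqw.
  have -> : (f == e) = (enum_rank_in eZ f == enum_rank_in eZ e).
    apply/eqP/eqP => [-> //|/(congr1 enum_val)].
    by rewrite !enum_rankK_in.
  rewrite -eqw; apply: eq_bigr => k _; rewrite ![in RHS]mxE enum_rankK_in // mulrC.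
  by congr (_ * _); rewrite !mxE.
exists (sweep_signvec a u); last first.
  by rewrite sweep_signvecE sign_of_eq0 slopeu // eqxx oner_eq0.
apply/contractP; split; first by apply/sweep_omP; exists u.
move=> f /setD1P[/negbTE fe fZ]; apply/eqP.
by rewrite sweep_signvecE sign_of_eq0 slopeu // fe.
Qed.

(* Rooting each tree at its least point, give each point the sum of the basis
   vectors attached to the edges on its path to the root; then the edges of the
   forest become basis vectors. *)
Lemma exists_independent_forest (Z : {set pairs n}) :
  increasing_forest Z -> (#|Z| <= d)%N ->
  exists a : 'M[R]_(n, d), \det (forest_mx a Z) != 0.
Proof.
move=> forZ leZ.
(* [p] is the parent map, fixing the roots. *)
pose p (i : 'I_n) := if [pick e in Z | (val e).2 == i] is Some e then (val e).1 else i.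
have pZ e : e \in Z -> p (val e).2 = (val e).1.
  move=> eZ; rewrite /p; case: pickP => [f /andP[fZ /eqP eq2]|/(_ e)].
    by rewrite (forZ _ _ fZ eZ eq2).
  by rewrite eZ eqxx.
have p_leq i : (p i <= i)%N.
  rewrite /p; case: pickP => // e /andP[_ /eqP <-]; exact/ltnW/pair_lt.
have connect_leq i j : fconnect p i j -> (j <= i)%N.
  move=> /iter_findex <-; elim: (findex p i j) => //= m IHm.
  exact: leq_trans (p_leq _) IHm.
pose a : 'M[R]_(n, d) := \matrix_(i, k)
  [exists c : 'I_#|Z|, (c == k :> nat) && fconnect p i (val (enum_val c)).2]%:R.
exists a; suff -> : forest_mx a Z = 1%:M by rewrite det1 oner_eq0.
rewrite /forest_mx (_ : (\matrix_(i, k) _) = pid_mx #|Z|); last first.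
  apply/matrixP=> i k; rewrite !mxE ltn_ord andbT.
  have eZ := enum_valP i; set e := enum_val i in eZ *.
  have [ik|ik] := eqVneq (i : nat) (k : nat).
    have -> : [exists c : 'I_#|Z|, (c == k :> nat) && fconnect p (val e).2 (val (enum_val c)).2].
      by apply/existsP; exists i; rewrite -ik eqxx connect0.
    rewrite (_ : [exists c, _] = false) ?subr0 //.
    apply/existsP=> -[c /andP[/eqP ck]].
    have -> : c = i by apply: ord_inj; rewrite ck ik.
    by move/connect_leq; rewrite leqNgt pair_lt.
  apply/eqP; rewrite subr_eq0; apply/eqP; congr (_%:R); congr nat_of_bool.
  apply: eq_existsb => c; case: eqP => //= ck.
  (* Distinct edges have distinct larger ends, so a path from [(val e).2] to the larger end of
     another edge goes through the parent. *)
  rewrite -(pZ e eZ); apply/idP/idP; last exact: connect_trans (fconnect1 _ _).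
  move=> con; move: (con); rewrite fconnect_eqVf => /orP[/eqP eq2|//].
  case/eqP: ik; rewrite -ck; congr nat_of_ord; apply: enum_val_inj.
  exact: forZ (enum_valP _) (enum_valP _) eq2.
by rewrite pid_mx_id // pid_mx_1.
Qed.

(** The polynomial is the product of the determinants of all relevant forests; each factor is
    nonzero because it is nonzero at one configuration. *)
Lemma generically_independent :
  generically (fun a : 'M[R]_(n, d) => forall Z, increasing_forest Z ->
    (#|Z| <= d)%N -> \det (forest_mx a Z) != 0).
Proof.
pose x : 'M[{mpoly R[n * d]}]_(n, d) := \matrix_(i, k) 'X_(mxvec_index i k).
pose good (Z : {set pairs n}) := `[< increasing_forest Z >] && (#|Z| <= d)%N.
have evalx a : map_mx (meval (fun k => mxvec a 0 k)) x = a.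
  by apply/matrixP=> i k; rewrite !mxE mevalXU mxvecE.
have eval_det a Z : (\det (forest_mx x Z)).@[fun k => mxvec a 0 k] = \det (forest_mx a Z).
  by rewrite -det_map_mx map_forest_mx evalx.
exists (\prod_(Z | good Z) \det (forest_mx x Z)); split.
  apply/prodf_neq0 => Z /andP[/asboolP forZ leZ].
  have [a nz] := exists_independent_forest forZ leZ.
  by apply: contraNneq nz => eq0; rewrite -eval_det eq0 meval0.
move=> a; rewrite rmorph_prod => /prodf_neq0 nz Z forZ leZ.
by rewrite -eval_det nz // /good leZ andbT; apply/asboolP.
Qed.

End Generic.

(** With loops there are no sweep permutations but still topes, hence two separate bounds. *)
Theorem theorem5p6 (R : realType) (n : nat) :
  (forall (r : nat) (L : {set signvec (pairs n)}),
     sweep_oriented_matroid L -> rank L = r -> 0 < r ->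
     [/\ #|sweep_permutations L| <= sweep_bound n r,
         #|topes L| <= sweep_bound n r
       & loopless L -> #|sweep_permutations L| = #|topes L|])
  /\
  (forall d : nat, 0 < d -> 1 < n ->
     generically (fun a : 'M[R]_(n, d) =>
       [/\ sweep_oriented_matroid (sweep_om a),
           rank (sweep_om a) = minn d (n - 1),
           #|sweep_permutations (sweep_om a)|
             = sweep_bound n (rank (sweep_om a))
         & #|topes (sweep_om a)| = sweep_bound n (rank (sweep_om a))])).
Proof.
split=> [r L sweepL <- r0|d d0 n1].
  have [omL _] := sweepL; have woL := sweep_weak_orders sweepL.
  have rn := sweep_rank_ltn woL r0.
  rewrite -generic_count_bound ?r0 // card_sweep_permutations //; split.
  - exact: sweep_count_leq.
  - exact: topes_count_leq.
  - by move=> /(card_topes_loopless omL) ->.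
have [P [P0 HP]] := generically_independent R n d.
exists P; split=> // a /HP/free_on_forests_sweep_om free.
have sweepL := sweep_om_sweep a; have [omL _] := sweepL.
have woL := sweep_weak_orders sweepL.
(* A single pair is a forest with one edge, and [d] is positive. *)
have ll : loopless (sweep_om a).
  move=> e; have [|||X /contractP[XL _] Xe] := free [set e] _ _ e.
  - by move=> f g /set1P -> /set1P ->.
  - by rewrite cards1.
  - exact: set11.
  - by exists X.
have ub := sweep_count_leq omL woL.
have lb : generic_count n d <= num_full (sweep_om a) setT.
  have := @num_full_geq _ _ setT set0 d omL woL free.
  rewrite cards0 subn0 cardsT card_ord innerT.
  have -> : contract (sweep_om a) set0 = sweep_om a.
    apply/setP=> X; apply/contractP/idP => [[]//|XL].
    by split=> // e; rewrite inE.
  by apply=> // [e f|e]; rewrite inE.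
have rank_min : rank (sweep_om a) <= minn d (n - 1).
  by rewrite leq_min rank_sweep_om subn1 weak_orders_rank.
have count_min : generic_count n d = generic_count n (minn d (n - 1)).
  rewrite /minn; case: ltnP => // le; case: n n1 le {a P P0 HP free sweepL omL woL ll ub lb rank_min} => // m _.
  by rewrite subn1; apply: generic_count_sat.
(* A smaller rank would push the upper bound [ub] strictly below the lower bound [lb]. *)
have rankE : rank (sweep_om a) = minn d (n - 1).
  apply/eqP; rewrite eqn_leq rank_min leqNgt; apply/negP=> lt.
  have lt_n : minn d (n - 1) < n by lia.
  have := generic_count_ltn lt lt_n.
  by rewrite -count_min ltnNge (leq_trans lb ub).
have countE : num_full (sweep_om a) setT = sweep_bound n (rank (sweep_om a)).
  rewrite -generic_count_bound; last by rewrite rankE; lia.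
  by apply/eqP; rewrite eqn_leq ub rankE -count_min.
by split; rewrite ?card_sweep_permutations ?card_topes_loopless.
Qed.
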